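(* Let $\mathbf{X}=\mathbf{X}(n,q^s)$ be a lattice design and $\mathcal{S}=\{1,\dots,s\}$. The Schur-combinatorial criterion satisfies $$\Psi_C(\mathbf{X};j)=\sum_{u\subseteq\mathcal{S},\,|u|=j}\ \sum_{\mathbf{x}\in\mathcal{L}(q^j)}\left(N_{\mathbf{x}}^{(u)}-\frac{n}{q^j}\right)^2\qquad\text{for } j=1,\dots,s,$$ where $N_{\mathbf{x}}^{(u)}$ is the number of runs of $\mathbf{X}$ whose $u$-coordinates take the level-combination $\mathbf{x}$. Further, for $1\le t\le s$, the design $\mathbf{X}$ has orthogonal strength $t$ if and only if $\Psi_C(\mathbf{X};j)=0$ for $j=1,\dots,t$.
   Context: Let $n,q\ge2$, $s\ge1$ be integers and $\mathcal{L}(q^j)=\{0,1,\dots,q-1\}^j$. A lattice design $\mathbf{X}(n,q^s)$ is a collection of $n$ points (runs, repetitions allowed) $\mathbf{x}_1,\dots,\mathbf{x}_n\in\mathcal{L}(q^s)$, written as an $n\times s$ matrix $(x_{ij})$. For a subset $u\subseteq\mathcal{S}$ with $|u|=j$, the $u$-coordinates of a run are its entries in the columns in $u$ (in increasing order), an element of $\mathcal{L}(q^j)$. Let $m=n(n-1)/2$ and let $\beta_1,\dots,\beta_m$ be the list of pairwise coincidences $\beta(\mathbf{x}_i,\mathbf{x}_k)=\sum_{j=1}^s\delta_{x_{ij},x_{kj}}$ for $1\le i<k\le n$. The Schur-combinatorial criterion is $$\Psi_C(\mathbf{X};j)=2\sum_{r=1}^m\binom{\beta_r}{j}-\binom{s}{j}\left(\frac{n^2}{q^j}-n\right),\qquad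 j=1,\dots,s,$$ where $\binom{x}{j}=0$ if $x<j$ and $\binom{x}{j}=\frac{1}{j!}x(x-1)\cdots(x-j+1)$ otherwise. $\mathbf{X}$ has orthogonal strength $t$ (is an orthogonal array $\mathrm{OA}(n,s,q,t)$) if for any $t$ columns of $\mathbf{X}$ all $q^t$ possible level combinations appear equally often among the $n$ runs. *)

(* Defs.v *)
From mathcomp Require Import all_boot all_order all_algebra.

Set Implicit Arguments.
Unset Strict Implicit.
Unset Printing Implicit Defensive.

Import GRing.Theory.
Local Open Scope ring_scope.

(* Run [i] is the i-th row; rows may be repeated. *)
Definition design (n q s : nat) := 'M['I_q]_(n, s).

Definition lattice (q j : nat) := j.-tuple 'I_q.

Definition coincidence (n q s : nat) (X : design n q s) (i k : 'I_n) : nat :=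
  (\sum_(j < s) (X i j == X k j))%N.

Definition Psi_C (n q s : nat) (X : design n q s) (j : nat) : rat :=
  2 * (\sum_(p : 'I_n * 'I_n | (p.1 < p.2)%N)
         'C(coincidence X p.1 p.2, j)%:R)
  - 'C(s, j)%:R * (n%:R ^+ 2 / q%:R ^+ j - n%:R).

(* [enum u] lists the columns in [u] in increasing order. *)
Definition coords (n q s : nat) (X : design n q s) (u : {set 'I_s})
    (i : 'I_n) : seq 'I_q :=
  [seq X i k | k <- enum u].

(* The comparison is between sequences, so that [x] can be taken in
   [lattice q j] for any [u] with [#|u| = j], without a cast. *)
Definition runs_count (n q s : nat) (X : design n q s) (u : {set 'I_s})
    (j : nat) (x : lattice q j) : nat :=
  #|[set i : 'I_n | coords X u i == x :> seq 'I_q]|.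

Definition orthogonal_strength (n q s : nat) (X : design n q s) (t : nat) :
    Prop :=
  forall u : {set 'I_s}, #|u| = t ->
  forall x y : lattice q t, runs_count X u x = runs_count X u y.

(* Main.v *)
(** For a fixed set [u] of columns, the sum of the squared counts is the number
    of ordered pairs of runs that agree on [u], and the counts add up to [n],
    so the variance sum equals that number of pairs minus [n ^ 2 / q ^ j].
    Summing over [u], two runs with coincidence [b] agree on ['C(b, j)] of the
    sets of size [j]; the diagonal pairs account for the term [n * 'C(s, j)].
    A sum of squares vanishes iff all the counts equal [n / q ^ j], which is
    strength [j]; and strength [t.+1] implies strength [t] because a count on
    [u] is the sum of the counts on [k |: u] over the levels of column [k]. *)

Require Import Defs.
From mathcomp Require Import all_boot all_order all_algebra.
From mathcomp Require Import ring.

Set Implicit Arguments.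
Unset Strict Implicit.
Unset Printing Implicit Defensive.

Import Order.TTheory GRing.Theory Num.Theory.
Local Open Scope ring_scope.

Section Counts.

Variables (n q s : nat) (X : design n q s).
Implicit Types (u : {set 'I_s}) (i k : 'I_n).

Lemma size_coords u i : size (coords X u i) = #|u|.
Proof. by rewrite size_map -cardE. Qed.

Lemma coords_eq_map u i (f : 'I_s -> 'I_q) :
  (coords X u i == [seq f c | c <- enum u]) = [forall c in u, X i c == f c].
Proof.
apply/eqP/forall_inP => [/eq_in_map eXf c uc | eXf].
  by apply/eqP/eXf; rewrite mem_enum.
by apply/eq_in_map => c; rewrite mem_enum => /eXf/eqP.
Qed.

(** A column of [u] receives the entry of [x] at its rank in [enum u]; [a0] fills the columns
    outside [u]. *)
Lemma lattice_coords_map (a0 : 'I_q) u j (x : lattice q j) :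
  #|u| = j -> exists f : 'I_s -> 'I_q, tval x = [seq f c | c <- enum u].
Proof.
move=> uj; exists (fun c => nth a0 x (index c (enum u))).
apply: (@eq_from_nth _ a0); first by rewrite size_map -cardE uj size_tuple.
move=> b; rewrite size_tuple => ltb.
have [c0 _] : exists c0, c0 \in u.
  by apply/card_gt0P; rewrite uj; apply: leq_ltn_trans ltb.
by rewrite (nth_map c0) ?index_uniq ?enum_uniq -?cardE ?uj.
Qed.

Lemma runs_countE u j (x : lattice q j) :
  runs_count X u x = (\sum_i (coords X u i == x :> seq 'I_q))%N.
Proof.
rewrite /runs_count -sum1_card big_mkcond; apply: eq_bigr => i _.
by rewrite inE; case: eqP.
Qed.

(** A run takes exactly one level combination on [u], so the indicator keeps a single term. *)
Lemma sum_pred1_coords u i j (F : lattice q j -> nat) (x0 : lattice q j) :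
  coords X u i = x0 ->
  (\sum_(x : lattice q j) (coords X u i == x :> seq 'I_q) * F x = F x0)%N.
Proof.
move=> ->; rewrite (bigD1 x0) //= eqxx mul1n big1 ?addn0 // => x.
by rewrite -val_eqE eq_sym /= => /negPf->.
Qed.

Lemma coords_tuple u i j : #|u| = j -> {x0 : lattice q j | coords X u i = x0}.
Proof.
by move=> uj; have /eqP sz := etrans (size_coords u i) uj; exists (Tuple sz).
Qed.

Lemma sum_runs_count u j :
  #|u| = j -> (\sum_(x : lattice q j) runs_count X u x = n)%N.
Proof.
move=> uj; under eq_bigr do rewrite runs_countE.
rewrite exchange_big -[RHS]card_ord -sum1_card; apply: eq_bigr => i _.
have [x0 ix0] := coords_tuple i uj.
rewrite -[RHS](sum_pred1_coords (fun=> 1%N) ix0).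
by apply: eq_bigr => x; rewrite muln1.
Qed.

Lemma sum_runs_count_sqr u j : #|u| = j ->
  (\sum_(x : lattice q j) runs_count X u x ^ 2 =
   \sum_i \sum_k (coords X u i == coords X u k))%N.
Proof.
move=> uj.
(* Only one factor of the square is expanded over runs [i]; the other is then evaluated at the
   combination of run [i], where it counts the runs agreeing with [i] on [u]. *)
under [LHS]eq_bigr => x _ do
  rewrite -mulnn [X in (X * _)%N]runs_countE big_distrl.
rewrite exchange_big; apply: eq_bigr => i _.
have [x0 ix0] := coords_tuple i uj.
rewrite (sum_pred1_coords (fun x => runs_count X u x) ix0) runs_countE.
by apply: eq_bigr => k _; rewrite ix0 eq_sym.
Qed.

Lemma coincidence_card i k :
  coincidence X i k = #|[set c | X i c == X k c]|.
Proof.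
by rewrite -sum1_card big_mkcond; apply: eq_bigr => c _; rewrite inE; case: eqP.
Qed.

Lemma coincidence_sym i k : coincidence X i k = coincidence X k i.
Proof. by apply: eq_bigr => c _; rewrite eq_sym. Qed.

Lemma coincidence_diag i : coincidence X i i = s.
Proof.
by rewrite -[RHS]card_ord -sum1_card; apply: eq_bigr => c _; rewrite eqxx.
Qed.

(** Two runs agree on [u] exactly when [u] lies inside the set of columns where they coincide. *)
Lemma sum_coords_eq j i k :
  (\sum_(u : {set 'I_s} | #|u| == j) (coords X u i == coords X u k) =
   'C(coincidence X i k, j))%N.
Proof.
rewrite coincidence_card -cards_draws -sum1_card big_mkcond [RHS]big_mkcond.
apply: eq_bigr => u _; rewrite inE [coords X u k]/coords coords_eq_map andbC.
case: (#|u| == j) => //=; congr nat_of_bool.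
by apply/forall_inP/subsetP => H c uc; move: (H c uc); rewrite inE.
Qed.

Lemma sum_ordered_pairs (F : 'I_n -> 'I_n -> nat) :
  (forall i k, F i k = F k i) ->
  (\sum_i \sum_k F i k =
   2 * (\sum_(p : 'I_n * 'I_n | p.1 < p.2) F p.1 p.2) + \sum_i F i i)%N.
Proof.
move=> Fsym; rewrite pair_big /=.
rewrite (bigID (fun p : 'I_n * 'I_n => p.1 < p.2)%N) /=.
rewrite mul2n -addnn -addnA; congr addn.
rewrite (bigID (fun p : 'I_n * 'I_n => p.2 < p.1)%N) /=; congr addn.
  (* Swapping the two runs matches the pairs on one side of the diagonal with those on the other. *)
  rewrite (reindex_inj (can_inj (@swap_pairK _ _))) /=.
  apply: eq_big => [[i k]|[i k] _] //=.
  by case: ltngtP.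
transitivity (\sum_i \sum_(k | k == i) F i k)%N.
  rewrite pair_big_dep /=; apply: eq_bigl => -[i k] /=.
  by rewrite -val_eqE /=; case: ltngtP.
by apply: eq_bigr => i _; rewrite big_pred1_eq.
Qed.

Hypothesis q_gt0 : (0 < q)%N.

Lemma sum_sqr_deviation u j : #|u| = j ->
  \sum_(x : lattice q j) ((runs_count X u x)%:R - n%:R / q%:R ^+ j) ^+ 2 =
  (\sum_i \sum_k (coords X u i == coords X u k))%N%:R - n%:R ^+ 2 / q%:R ^+ j
  :> rat.
Proof.
move=> uj; have qj0 : (q%:R : rat) ^+ j != 0.
  by rewrite expf_neq0 // pnatr_eq0 -lt0n.
under [LHS]eq_bigr do rewrite sqrrB.
rewrite big_split sumrB /= sumr_const card_tuple card_ord.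
under [X in _ - X]eq_bigr do rewrite -mulrnAr.
rewrite -mulr_suml -natr_sum sum_runs_count //.
rewrite -(sum_runs_count_sqr uj) natr_sum.
under [in RHS]eq_bigr do rewrite natrX.
(* The cross term gives [- 2 * n ^ 2 / q ^ j], and the [q ^ j] constant terms add back
   [n ^ 2 / q ^ j]. *)
by rewrite -[X in _ + X]mulr_natr natrX -mulr_natr; field.
Qed.

Theorem Psi_C_sum_sqr j :
  Psi_C X j =
    \sum_(u : {set 'I_s} | #|u| == j)
      \sum_(x : lattice q j)
        ((runs_count X u x)%:R - n%:R / q%:R ^+ j) ^+ 2.
Proof.
under [RHS]eq_bigr => u /eqP uj do rewrite sum_sqr_deviation //.
rewrite sumrB -natr_sum exchange_big.
under [X in X%:R - _]eq_bigr => i _ do rewrite exchange_big.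
under [X in X%:R - _]eq_bigr => i _ do
  under eq_bigr => k _ do rewrite sum_coords_eq.
rewrite sum_ordered_pairs => [|i k]; last by rewrite coincidence_sym.
under [X in (_ + X)%N]eq_bigr do rewrite coincidence_diag.
rewrite sum_nat_const card_ord sumr_const.
have -> : #|[pred u : {set 'I_s} | #|u| == j]| = 'C(s, j).
  by rewrite -[s in RHS]card_ord -card_draws cardsE; apply: eq_card.
rewrite /Psi_C natrD !natrM natr_sum -mulr_natr.
ring.
Qed.

Lemma Psi_C_eq0 j : Psi_C X j = 0 <-> orthogonal_strength X j.
Proof.
have qj0 : (q%:R : rat) ^+ j != 0.
  by rewrite expf_neq0 // pnatr_eq0 -lt0n.
rewrite Psi_C_sum_sqr; split => [/eqP | str].
  rewrite psumr_eq0 => [/allP H u uj x y|u _]; last first.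
    by apply: sumr_ge0 => x _; apply: sqr_ge0.
  have := H u (mem_index_enum _); rewrite uj eqxx /=.
  rewrite psumr_eq0 => [/allP {}H|z _]; last exact: sqr_ge0.
  have {}H (z : lattice q j) : (runs_count X u z)%:R = n%:R / q%:R ^+ j :> rat.
    by have := H z (mem_index_enum _); rewrite sqrf_eq0 subr_eq0 => /eqP.
  by apply/eqP; rewrite -(eqr_nat rat) !H.
apply: big1 => u /eqP uj; apply: big1 => x _.
(* The [q ^ j] counts on [u] add up to [n] and, by strength, all equal the one at [x]. *)
have nE : n%:R = q%:R ^+ j * (runs_count X u x)%:R :> rat.
  rewrite -{1}(sum_runs_count uj); under eq_bigr do rewrite (str u uj _ x).
  by rewrite sum_nat_const card_tuple card_ord natrM natrX.
by rewrite nE mulrC mulKf // subrr expr0n.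
Qed.

(** Levels prescribed by functions on all columns, rather than by tuples, let [u] gain a column
    without shifting the positions of the others. *)
Lemma orthogonal_strengthP j :
  orthogonal_strength X j <->
  forall u, #|u| = j -> forall f g : 'I_s -> 'I_q,
    #|[set i | [forall c in u, X i c == f c]]| =
    #|[set i | [forall c in u, X i c == g c]]|.
Proof.
have count_map u (x : lattice q j) f : tval x = [seq f c | c <- enum u] ->
    runs_count X u x = #|[set i | [forall c in u, X i c == f c]]|.
  move=> xf; rewrite /runs_count; congr #|pred_of_set _|.
  by apply/setP => i; rewrite !inE xf coords_eq_map.
split=> [str u uj f g | bal u uj x y].
  have sz (h : 'I_s -> 'I_q) : size [seq h c | c <- enum u] == j.
    by rewrite size_map -cardE uj.
  rewrite -(count_map u (Tuple (sz f))) // -(count_map u (Tuple (sz g))) //.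
  exact: str.
have [f xf] := lattice_coords_map (Ordinal q_gt0) x uj.
have [g yg] := lattice_coords_map (Ordinal q_gt0) y uj.
by rewrite (count_map _ _ _ xf) (count_map _ _ _ yg); apply: bal.
Qed.

Lemma orthogonal_strengthS j : (j < s)%N ->
  orthogonal_strength X j.+1 -> orthogonal_strength X j.
Proof.
move=> ltjs /orthogonal_strengthP str; apply/orthogonal_strengthP => u uj f g.
have [c ucN] : exists c, c \notin u.
  apply/existsP; rewrite -negb_forall; apply: contraL ltjs => /forallP uT.
  rewrite -leqNgt -uj -[leqLHS]card_ord.
  by apply/subset_leq_card/subsetP => c _; apply: uT.
(* The runs are sorted by their level [a] in the new column [c]; each class is a count on [c |: u],
   to which strength [j.+1] applies. *)
have split_level h : #|[set i | [forall d in u, X i d == h d]]| =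
    (\sum_(a : 'I_q) #|[set i | [forall d in c |: u,
      X i d == [eta h with c |-> a] d]]|)%N.
  rewrite -sum1_card (partition_big (fun i => X i c) predT) //=.
  apply: eq_bigr => a _; rewrite sum1dep_card; apply: eq_card => i.
  rewrite !inE; apply/andP/forall_inP => [[/forall_inP H /eqP <-] d | H].
    by rewrite in_setU1; case: eqVneq => [->|_] //=; apply: H.
  split; last by have := H c (setU11 _ _); rewrite /= eqxx.
  apply/forall_inP => d ud; have := H d (setU1r _ ud).
  (* Since [c] is not in [u], changing the value of [h] at [c] leaves its values on [u] intact. *)
  by rewrite /=; case: (eqVneq d c) ucN => // <-; rewrite ud.
rewrite !split_level; apply: eq_bigr => a _; apply: str.
by rewrite cardsU1 ucN uj.
Qed.

Lemma orthogonal_strength_le j t : (j <= t <= s)%N ->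
  orthogonal_strength X t -> orthogonal_strength X j.
Proof.
case/andP=> + les; elim: t les => [|t IHt] les.
  by rewrite leqn0 => /eqP->.
rewrite leq_eqVlt => /predU1P[-> //|lejt] str.
by apply: IHt => //; [apply: ltnW | apply: orthogonal_strengthS].
Qed.

End Counts.

Unset Implicit Arguments.

Theorem theorem2 (n q s : nat) (hn : (2 <= n)%N) (hq : (2 <= q)%N)
    (hs : (1 <= s)%N) (X : design n q s) :
  (forall j : nat, (1 <= j <= s)%N ->
     Psi_C X j =
       \sum_(u : {set 'I_s} | #|u| == j)
         \sum_(x : lattice q j)
           ((runs_count X u x)%:R - n%:R / q%:R ^+ j) ^+ 2)
  /\
  (forall t : nat, (1 <= t <= s)%N ->
     (orthogonal_strength X t <->
      forall j : nat, (1 <= j <= t)%N -> Psi_C X j = 0)).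
Proof.
have q_gt0 : (0 < q)%N by apply: ltnW.
split=> [j _ | t /andP[t_gt0 lets]]; first exact: Psi_C_sum_sqr.
split=> [str j /andP[_ lejt] | Psi0].
  apply/(Psi_C_eq0 X q_gt0).
  by apply: orthogonal_strength_le str; rewrite ?lejt.
(* The case [j = t] of the vanishing gives strength [t]. *)
by apply/(Psi_C_eq0 X q_gt0)/Psi0; rewrite t_gt0 leqnn.
Qed.
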